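(* Let $(\chi,\mu)$ be a $\sigma$-finite measure space and let $p,q\in\Omega$ be probability densities with respect to $\mu$. Then for all $-\infty\le\alpha<\beta\le\infty$, $$1-\tfrac12 D_v(p,q)\ \le\ D_{M^{[\alpha]}}(p,q)\ \le\ D_{M^{[\beta]}}(p,q)\ \le\ 1+\tfrac12 D_v(p,q).$$ In particular, $$1-\tfrac12 D_v(p,q)\le D_{Ha}(p,q)\le D_B(p,q)\le 1+\tfrac12 D_v(p,q).$$
   Context: $\Omega$ is the set of measurable functions $p:\chi\to\mathbb{R}$ with $p(x)\ge 0$ and $\int_\chi p\,d\mu=1$. For $a,b>0$ the $\alpha$-th power mean is $M^{[\alpha]}(a,b)=\left(\frac{a^\alpha+b^\alpha}{2}\right)^{1/\alpha}$ for $\alpha\in\mathbb{R}\setminus\{0\}$, and $M^{[0]}(a,b)=\sqrt{ab}$. Each is extended to $[0,\infty)^2$ by continuity. The variation distance is $D_v(p,q)=\int_\chi|p(x)-q(x)|\,d\mu(x)$. The $\alpha$-power divergence measure is $D_{M^{[\alpha]}}(p,q)=\int_\chi M^{[\alpha]}(p(x),q(x))\,d\mu(x)$ for $\alpha\in\mathbb{R}$, with $D_{M^{[+\infty]}}(p,q)=1+\frac12D_v(p,q)$ and $D_{M^{[-\infty]}}(p,q)=1-\frac12D_v(p,q)$. The harmonic divergence is $D_{Ha}(p,q)=\int_\chi\frac{2p(x)q(x)}{p(x)+q(x)}\,d\mu(x)$ (integrand taken to be $0$ where $p(x)=q(x)=0$), and the Bhattacharyya distance is $D_B(p,q)=\int_\chi\sqrt{p(x)q(x)}\,d\mu(x)$.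 *)

(* Defs.v *)
From HB Require Import structures.
From mathcomp Require Import all_boot all_order all_algebra.
From mathcomp Require Import all_classical all_reals all_analysis.

Set Implicit Arguments.
Unset Strict Implicit.
Unset Printing Implicit Defensive.

Import Order.TTheory GRing.Theory Num.Theory.
Import numFieldNormedType.Exports.

Local Open Scope classical_set_scope.
Local Open Scope ring_scope.

Definition power_mean_pos {R : realType} (alpha a b : R) : R :=
  if alpha == 0 then Num.sqrt (a * b)
  else ((a `^ alpha + b `^ alpha) / 2) `^ (alpha^-1).

(* [power_mean_pos] is only meaningful on the open quadrant: [powR] sets
   [0 `^ alpha = 0] also for [alpha < 0], which is not the continuous value.
   On the boundary of [0, +oo[ ^ 2 the mean is the limit taken from inside the
   open quadrant; the values at points with a negative coordinate are junk. *)
Definition power_mean {R : realType} (alpha a b : R) : R :=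
  if (0 < a) && (0 < b) then power_mean_pos alpha a b
  else lim (power_mean_pos alpha u.1 u.2
              @[u --> within [set u : R * R | 0 < u.1 /\ 0 < u.2]
                        (nbhs (a, b))]).

Section divergences.
Context {d : measure_display} {T : measurableType d} {R : realType}.
Implicit Types (p q : T -> R).

Definition density (mu : {measure set T -> \bar R}) p : Prop :=
  [/\ measurable_fun [set: T] p, (forall x, 0 <= p x) &
      (\int[mu]_x (p x)%:E = 1)%E].

Local Open Scope ereal_scope.

Definition variation_distance (mu : {measure set T -> \bar R}) p q : \bar R :=
  \int[mu]_x (`|p x - q x|%R)%:E.

Definition power_divergence (mu : {measure set T -> \bar R})
    (alpha : \bar R) p q : \bar R :=
  match alpha with
  | r%:E => \int[mu]_x (power_mean r (p x) (q x))%:E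
  | +oo => 1 + (2^-1)%:E * variation_distance mu p q
  | -oo => 1 - (2^-1)%:E * variation_distance mu p q
  end.

(* Since [0^-1 = 0], the integrand is 0 where [p] and [q] both vanish. *)
Definition harmonic_divergence (mu : {measure set T -> \bar R}) p q : \bar R :=
  \int[mu]_x ((2 * p x * q x) / (p x + q x))%R%:E.

Definition bhattacharyya (mu : {measure set T -> \bar R}) p q : \bar R :=
  \int[mu]_x (Num.sqrt (p x * q x))%:E.

End divergences.

(* Main.v *)
(* For fixed a, b >= 0 the power mean M^[alpha](a, b) is nondecreasing in alpha,
   with limits min(a, b) and max(a, b) at -oo and +oo: between positive exponents
   this is the convexity of t |-> t^(beta/alpha), between 0 and a positive
   exponent it is AM-GM, and negative exponents reduce to positive ones by
   M^[-alpha](a, b) = 1 / M^[alpha](1/a, 1/b). As min and max are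
   (p + q -/+ |p - q|) / 2, their integrals are 1 -/+ D_v / 2, so integrating the
   pointwise chain gives the claim; D_Ha and D_B are the cases alpha = -1, 0. *)
Require Import Defs.
From HB Require Import structures.
From mathcomp Require Import all_boot all_order all_algebra.
From mathcomp Require Import all_classical all_reals all_analysis.
From mathcomp Require Import measurable_realfun ring lra.

Set Implicit Arguments.
Unset Strict Implicit.
Unset Printing Implicit Defensive.

Import Order.TTheory GRing.Theory Num.Theory.
Import numFieldNormedType.Exports.

Local Open Scope classical_set_scope.
Local Open Scope ring_scope.

(** * Monotonicity and bounds for the explicit mean formula *)

Section power_mean_pos.
Context {R : realType}.
Implicit Types (a b r s x : R).

Lemma power_mean_pos_ge0 r a b : 0 <= power_mean_pos r a b.
Proof.
by rewrite /power_mean_pos; case: ifP => _; rewrite ?sqrtr_ge0 ?powR_ge0.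
Qed.

Lemma power_mean_pos0 a b : power_mean_pos 0 a b = Num.sqrt (a * b).
Proof. by rewrite /power_mean_pos eqxx. Qed.

Lemma power_mean_posE r a b : r != 0 ->
  power_mean_pos r a b = ((a `^ r + b `^ r) / 2) `^ r^-1.
Proof. by rewrite /power_mean_pos => /negPf ->. Qed.

Lemma powRVl r a : 0 <= a -> a^-1 `^ r = (a `^ r)^-1.
Proof. by move=> a0; rewrite -powRN -(powR_inv1 a0) -powRrM mulN1r. Qed.

(** Holds at zero arguments too, because [0^-1 = 0] agrees with the convention for powers of 0. *)
Lemma power_mean_posN r a b : 0 <= a -> 0 <= b ->
  power_mean_pos (- r) a b = (power_mean_pos r a^-1 b^-1)^-1.
Proof.
move=> a0 b0; have [->|r0] := eqVneq r 0.
  by rewrite oppr0 !power_mean_pos0 -invfM sqrtrV ?mulr_ge0// invrK.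
by rewrite !power_mean_posE ?oppr_eq0// invrN !powRN !powRVl.
Qed.

Lemma powR_mean_le r a b : 1 <= r -> 0 <= a -> 0 <= b ->
  ((a + b) / 2) `^ r <= (a `^ r + b `^ r) / 2.
Proof.
move=> r1 a0 b0.
have half01 : 2^-1 <= 1 :> R by rewrite invf_le1 ?ler1n.
have half0 : 0 <= 2^-1 :> R by rewrite invr_ge0.
have := @convex_powR _ _ r1 (Itv01 half0 half01) a b.
rewrite !inE /= !in_itv /= !andbT => /(_ a0 b0).
rewrite convRE [X in X `^ _ <= _ -> _]convRE /= /unstable.onem.
rewrite (_ : 1 - 2^-1 = 2^-1); last lra.
by rewrite -!mulrDr !(mulrC 2^-1).
Qed.

Lemma power_mean_pos_homo_gt0 a b : 0 <= a -> 0 <= b ->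
  {in `]0, +oo[ &, {homo (power_mean_pos ^~ a) ^~ b : r s / r <= s}}.
Proof.
move=> a0 b0 r s; rewrite !in_itv /= !andbT => r0 s0 rs.
rewrite !power_mean_posE ?gt_eqF//.
have rs1 : 1 <= s / r by rewrite ler_pdivlMr// mul1r.
have powrs x : (x `^ r) `^ (s / r) = x `^ s.
  by rewrite -powRrM mulrCA divff ?gt_eqF// mulr1.
have := powR_mean_le rs1 (powR_ge0 a r) (powR_ge0 b r).
rewrite !powrs => h.
(* The outer root is split so that convexity with exponent [s / r] applies to the mean of the [r]-th
   powers; an [s]-th root then finishes. *)
have -> : r^-1 = (s / r) * s^-1 by rewrite mulrAC divff ?gt_eqF// mul1r.
by rewrite powRrM ge0_ler_powR ?invr_ge0 ?nnegrE ?powR_ge0 ?(ltW s0)//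
  divr_ge0 ?addr_ge0 ?powR_ge0.
Qed.

Lemma power_mean_pos0_le r a b : 0 < r -> 0 <= a -> 0 <= b ->
  power_mean_pos 0 a b <= power_mean_pos r a b.
Proof.
move=> r0 a0 b0; rewrite power_mean_pos0 power_mean_posE ?gt_eqF//.
have ab0 : 0 <= a * b by rewrite mulr_ge0.
(* Both sides become [r]-th roots, which leaves AM-GM for [a]^ r[and]b [^ r]. *)
rewrite [leLHS](_ : _ = (Num.sqrt (a `^ r * b `^ r)) `^ r^-1); last first.
  rewrite -powRM// -!powR12_sqrt ?powR_ge0// -!powRrM.
  by rewrite mulrCA divff ?gt_eqF// mulr1.
rewrite ge0_ler_powR ?invr_ge0 ?nnegrE ?sqrtr_ge0 ?(ltW r0)//.
  by rewrite divr_ge0 ?addr_ge0 ?powR_ge0.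
set x := a `^ r; set y := b `^ r.
have x0 : 0 <= x by exact: powR_ge0.
have y0 : 0 <= y by exact: powR_ge0.
rewrite -[leRHS]ger0_norm ?divr_ge0 ?addr_ge0// -sqrtr_sqr ler_wsqrtr//.
have := sqr_ge0 (x - y); lra.
Qed.

Lemma power_mean_pos_homo_ge0 r s a b : 0 <= r -> r <= s -> 0 <= a -> 0 <= b ->
  power_mean_pos r a b <= power_mean_pos s a b.
Proof.
rewrite le_eqVlt => /predU1P[<-|r0] rs a0 b0.
  by move: rs; rewrite le_eqVlt => /predU1P[<-//|/power_mean_pos0_le]; apply.
by apply: power_mean_pos_homo_gt0; rewrite // in_itv/= andbT// (lt_le_trans r0).
Qed.

Lemma power_mean_pos_gt0 r a b : 0 < a -> 0 < b -> 0 < power_mean_pos r a b.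
Proof.
move=> a0 b0; rewrite /power_mean_pos; case: ifP => _.
  by rewrite sqrtr_gt0 mulr_gt0.
by rewrite powR_gt0// divr_gt0// addr_gt0// powR_gt0.
Qed.

(** Positivity matters for negative exponents: at [a = 0] the formula gives [2 * b] for exponent -1
    but 0 for exponent 0. *)
Lemma power_mean_pos_homo r s a b : r <= s -> 0 < a -> 0 < b ->
  power_mean_pos r a b <= power_mean_pos s a b.
Proof.
move=> rs a0 b0.
have [r0|r0] := leP 0 r.
  by apply: power_mean_pos_homo_ge0 => //; exact: ltW.
have homo_le0 u v : u <= v -> v <= 0 ->
    power_mean_pos u a b <= power_mean_pos v a b.
  move=> uv v0; rewrite -[u]opprK -[v]opprK.
  rewrite !(@power_mean_posN (- _)) ?(ltW a0) ?(ltW b0)//.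
  rewrite lef_pV2 ?posrE ?power_mean_pos_gt0 ?invr_gt0//.
  by apply: power_mean_pos_homo_ge0;
    rewrite ?oppr_ge0 ?lerN2 ?invr_ge0 ?(ltW a0) ?(ltW b0).
have [s0|s0] := leP s 0; first exact: homo_le0.
apply: (@le_trans _ _ (power_mean_pos 0 a b)).
  by apply: homo_le0 => //; exact: ltW.
by apply: power_mean_pos_homo_ge0 => //; exact: ltW.
Qed.

Lemma power_mean_pos_le_max_gt0 r a b : 0 < r -> 0 <= a -> 0 <= b ->
  power_mean_pos r a b <= Num.max a b.
Proof.
move=> r0 a0 b0; rewrite power_mean_posE ?gt_eqF//.
have m0 : 0 <= Num.max a b by rewrite le_max a0.
rewrite [leRHS](_ : _ = (Num.max a b `^ r) `^ r^-1); last first.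
  by rewrite -powRrM divff ?gt_eqF// powRr1.
rewrite ge0_ler_powR ?invr_ge0 ?nnegrE ?powR_ge0 ?(ltW r0)//.
  by rewrite divr_ge0 ?addr_ge0 ?powR_ge0.
rewrite ler_pdivrMr// mulr_natr mulr2n.
by rewrite lerD// ge0_ler_powR ?nnegrE ?(ltW r0)// le_max lexx ?orbT.
Qed.

Lemma power_mean_pos_le_max r a b : 0 < a -> 0 < b ->
  power_mean_pos r a b <= Num.max a b.
Proof.
move=> a0 b0; apply: (@le_trans _ _ (power_mean_pos (`|r| + 1) a b)).
  by apply: power_mean_pos_homo => //; rewrite ler_wpDr// ler_norm.
by rewrite power_mean_pos_le_max_gt0 ?(ltW a0) ?(ltW b0)// ltr_wpDl.
Qed.

(** Dual to the upper bound: inverting the arguments negates the exponent and turns the minimum into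
    a maximum. *)
Lemma min_le_power_mean_pos r a b : 0 < a -> 0 < b ->
  Num.min a b <= power_mean_pos r a b.
Proof.
move=> a0 b0; rewrite -[r]opprK power_mean_posN ?(ltW a0) ?(ltW b0)//.
have m0 : 0 < Num.min a b by rewrite lt_min a0.
rewrite -[leLHS]invrK lef_pV2 ?posrE ?power_mean_pos_gt0 ?invr_gt0//.
apply: le_trans (power_mean_pos_le_max _ _ _) _; rewrite ?invr_gt0//.
by rewrite ge_max !lef_pV2 ?posrE// !ge_min !lexx orbT.
Qed.

End power_mean_pos.

(** * Continuous extension to the closed quadrant *)

Section power_mean.
Context {R : realType}.
Implicit Types (a b r s x : R).

Lemma continuous_normr_powR r : 0 < r -> continuous (fun x => `|x| `^ r).
Proof.
move=> r0 x; have [->|x0] := eqVneq x 0.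
  apply/cvgrPdist_lt => e e0.
  have : \forall y \near (0 : R), `|y| < e `^ r^-1.
    by apply: nbhs0_lt; rewrite powR_gt0.
  apply: filterS => y ye.
  rewrite normr0 powR0 ?gt_eqF// sub0r normrN ger0_norm ?powR_ge0//.
  rewrite [ltRHS](_ : e = (e `^ r^-1) `^ r); last first.
    by rewrite -powRrM mulVf ?gt_eqF// powRr1 // ltW.
  by rewrite gt0_ltr_powR ?nnegrE ?powR_ge0.
apply: (@continuous_cvg _ _ _ _ _ _ (@powR R ^~ r)); last exact: norm_continuous.
apply: differentiable_continuous; apply/derivable1_diffP.
by apply: derivable_powR; rewrite in_itv/= andbT normr_gt0.
Qed.

Definition quadrant : set (R * R) := [set u | 0 < u.1 /\ 0 < u.2].

(** Properness makes limits unique, so that a convergence proof determines the [lim] in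
    [power_mean]. *)
Lemma within_quadrant_proper a b : 0 <= a -> 0 <= b ->
  ProperFilter (within quadrant (nbhs (a, b))).
Proof.
move=> a0 b0; apply: within_nbhs_proper => U [/= [A B] [/= Aa Bb] ABU].
have h (c : R) (C : set R) : 0 <= c -> nbhs c C -> exists2 x, 0 < x & C x.
  move=> c0 /nbhs_ballP[e /= e0 eC]; exists (c + e / 2).
    by rewrite ltr_wpDl// divr_gt0.
  apply: eC; rewrite /ball /= opprD addNKr normrN ger0_norm ?divr_ge0 ?ltW//.
  by rewrite gtr_pMr// invf_lt1// ltr1n.
have [x x0 Ax] := h _ _ a0 Aa; have [y y0 By] := h _ _ b0 Bb.
by exists (x, y); split => //; apply: ABU.
Qed.

Lemma power_mean_pos_cvg r a b : 0 <= r -> 0 <= a -> 0 <= b ->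
  power_mean_pos r u.1 u.2 @[u --> within quadrant (nbhs (a, b))] -->
  power_mean_pos r a b.
Proof.
rewrite le_eqVlt => /predU1P[<-|r0] a0 b0.
  under eq_cvg do rewrite power_mean_pos0.
  rewrite power_mean_pos0; apply: cvg_within_filter.
  apply: continuous_cvg; first exact: sqrt_continuous.
  by apply: cvgM; [exact: cvg_fst|exact: cvg_snd].
(* The absolute values make [f] continuous on the whole plane, since [powR]
   jumps to 1 at negative arguments. *)
pose f (u : R * R) := `|(`|u.1| `^ r + `|u.2| `^ r) / 2| `^ r^-1.
have fE (u : R * R) : 0 <= u.1 -> 0 <= u.2 -> f u = power_mean_pos r u.1 u.2.
  move=> u1 u2; rewrite power_mean_posE ?gt_eqF// /f !(@ger0_norm _ u.1)//.
  by rewrite (@ger0_norm _ u.2)// ger0_norm// divr_ge0 ?addr_ge0 ?powR_ge0.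
rewrite -[X in _ --> X](fE (a, b))//.
apply: (@cvg_trans _ (f @ within quadrant (nbhs (a, b)))).
  apply: fmap_within_eq => u; rewrite inE => -[u1 u2].
  by rewrite fE// ltW.
apply: cvg_within_filter.
apply: (@continuous_cvg _ _ _ _ _ _ (fun x => `|x| `^ r^-1)).
  by apply: continuous_normr_powR; rewrite invr_gt0.
apply: cvgMr_tmp; apply: cvgD.
  apply: (@continuous_cvg _ _ _ _ _ _ (fun x => `|x| `^ r)); last exact: cvg_fst.
  exact: continuous_normr_powR.
apply: (@continuous_cvg _ _ _ _ _ _ (fun x => `|x| `^ r)); last exact: cvg_snd.
exact: continuous_normr_powR.
Qed.

Lemma power_mean_pos_cvg0 r a b : r < 0 -> 0 <= a -> 0 <= b -> a * b = 0 ->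
  power_mean_pos r u.1 u.2 @[u --> within quadrant (nbhs (a, b))] --> 0.
Proof.
move=> r0 a0 b0 ab0.
have PF := within_quadrant_proper a0 b0.
(* For [r < 0] the mean is dominated by the geometric mean, which vanishes at
   the boundary. *)
apply: (@squeeze_cvgr _ _ _ _ (cst 0) (fun u => power_mean_pos 0 u.1 u.2)).
- near=> u; have [u1 u2] : quadrant u by near: u; exact: near_withinT.
  by rewrite power_mean_pos_ge0/= power_mean_pos_homo// ltW.
- exact: cvg_cst.
- rewrite -[X in _ --> X](_ : power_mean_pos 0 a b = 0).
    exact: power_mean_pos_cvg.
  by rewrite power_mean_pos0 ab0 sqrtr0.
Unshelve. all: by end_near. Qed.

(* Under [powR]'s convention [0 `^ r = 0] for [r != 0], [power_mean_pos] already
   has the right boundary values, except when [r < 0]. *)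
Lemma power_meanE r a b : 0 <= a -> 0 <= b -> power_mean r a b =
  if (r < 0) && (a * b == 0) then 0 else power_mean_pos r a b.
Proof.
(* For nonnegative arguments the branch condition of [power_mean] amounts to [a * b != 0]. *)
move=> a0 b0; rewrite /power_mean !lt0r a0 b0 !andbT -negb_or -mulf_eq0.
have PF := within_quadrant_proper a0 b0.
case: ifPn => [/negPf ->|]; first by rewrite andbF.
rewrite negbK => ab0; rewrite ab0 andbT.
have [r0|r0] := ltP r 0; apply: cvg_lim => //.
  by apply: power_mean_pos_cvg0 => //; exact/eqP.
exact: power_mean_pos_cvg.
Qed.

(** Putting the limits in exponent at the infinite ends lets one pointwise monotonicity statement
    cover every inequality of the chain. *)
Definition ext_power_mean (alpha : \bar R) a b : R :=
  match alpha with
  | r%:E => power_mean r a b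
  | +oo%E => Num.max a b
  | -oo%E => Num.min a b
  end.

Lemma power_mean_homo r s a b : r <= s -> 0 <= a -> 0 <= b ->
  power_mean r a b <= power_mean s a b.
Proof.
move=> rs a0 b0; rewrite !power_meanE//.
(* On the boundary negative exponents give 0, and nonnegative ones follow the formula, which is
   monotone there. *)
have [ab0|] := eqVneq (a * b) 0.
  rewrite !andbT; have [r0|r0] := ltP r 0.
    by case: ifP => // _; exact: power_mean_pos_ge0.
  by rewrite ltNge (le_trans r0 rs)/= power_mean_pos_homo_ge0.
rewrite mulf_eq0 negb_or => /andP[a_neq0 b_neq0].
by rewrite !andbF power_mean_pos_homo ?lt0r ?a_neq0 ?b_neq0.
Qed.

Lemma power_mean_le_max r a b : 0 <= a -> 0 <= b ->
  power_mean r a b <= Num.max a b.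
Proof.
move=> a0 b0; apply: (@le_trans _ _ (power_mean (`|r| + 1) a b)).
  by rewrite power_mean_homo// ler_wpDr// ler_norm.
rewrite power_meanE// ltNge addr_ge0//=.
by rewrite power_mean_pos_le_max_gt0// ltr_wpDl.
Qed.

Lemma min_le_power_mean r a b : 0 <= a -> 0 <= b ->
  Num.min a b <= power_mean r a b.
Proof.
move=> a0 b0; rewrite power_meanE//.
have [/eqP|] := eqVneq (a * b) 0.
  rewrite mulf_eq0 andbT => ab0; apply: (@le_trans _ _ 0).
    by rewrite ge_min; case/orP: ab0 => /eqP ->; rewrite lexx ?orbT.
  by case: ifP => // _; exact: power_mean_pos_ge0.
rewrite mulf_eq0 negb_or => /andP[a_neq0 b_neq0].
by rewrite !andbF min_le_power_mean_pos ?lt0r ?a_neq0 ?b_neq0.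
Qed.

Lemma ext_power_mean_homo (alpha beta : \bar R) a b :
  (alpha <= beta)%E -> 0 <= a -> 0 <= b ->
  ext_power_mean alpha a b <= ext_power_mean beta a b.
Proof.
case: alpha beta => [r||] [s||]; rewrite /ext_power_mean.
- by rewrite lee_fin; exact: power_mean_homo.
- by move=> _; exact: power_mean_le_max.
- by rewrite leNgt ltNyr.
- by rewrite leNgt ltry.
- by move=> _ _ _; exact: lexx.
- by [].
- by move=> _; exact: min_le_power_mean.
- by move=> _ _ _; rewrite ge_min !le_max lexx.
- by move=> _ _ _; exact: lexx.
Qed.

Lemma power_meanN1 a b : 0 <= a -> 0 <= b ->
  power_mean (-1) a b = 2 * a * b / (a + b).
Proof.
move=> a0 b0; rewrite power_meanE// oppr_lt0 ltr01/=.
case: ifPn => [/eqP ab0|]; first by rewrite -(mulrA 2) ab0 mulr0 mul0r.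
rewrite mulf_eq0 negb_or => /andP[a_neq0 b_neq0].
(* The mean becomes the inverse of the arithmetic mean of the inverses. *)
rewrite power_mean_posN// power_mean_posE ?oner_eq0// invr1.
rewrite !powRr1 ?invr_ge0//; last by rewrite divr_ge0// addr_ge0 ?invr_ge0.
have : a + b != 0 by rewrite paddr_eq0// (negPf a_neq0).
by move=> ab; field; rewrite ab a_neq0 b_neq0.
Qed.

End power_mean.

(** * Measurability and integration of the pointwise chain *)

Section integrals.
Context {d : measure_display} {T : measurableType d} {R : realType}.
Variable mu : {measure set T -> \bar R}.
Implicit Types p q : T -> R.

Lemma measurable_power_mean_pos r p q :
  measurable_fun [set: T] p -> measurable_fun [set: T] q ->
  measurable_fun [set: T] (fun x => power_mean_pos r (p x) (q x)).
Proof.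
move=> mp mq; have mpow s (f : T -> R) : measurable_fun [set: T] f ->
    measurable_fun [set: T] (fun x => f x `^ s).
  by move=> mf; apply: (measurableT_comp (measurable_powR s)).
rewrite /power_mean_pos; case: (r == 0).
  apply: (@measurableT_comp _ _ _ _ _ _ (@Num.sqrt R)).
    by apply: continuous_measurable_fun; exact: sqrt_continuous.
  exact: measurable_funM.
apply: (mpow r^-1 (fun x => (p x `^ r + q x `^ r) / 2)).
by apply: measurable_funM => //; apply: measurable_funD; exact: mpow.
Qed.

Lemma measurable_ext_power_mean (alpha : \bar R) p q :
  (forall x, 0 <= p x) -> (forall x, 0 <= q x) ->
  measurable_fun [set: T] p -> measurable_fun [set: T] q ->
  measurable_fun [set: T] (fun x => ext_power_mean alpha (p x) (q x)).
Proof.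
move=> p0 q0 mp mq; case: alpha => [r||] /=.
(* The case formula replaces the limit, whose measurability is not apparent. *)
- under eq_fun do rewrite power_meanE//.
  apply: measurable_fun_ifT => //; last exact: measurable_power_mean_pos.
  case: (r < 0) => //=.
  by apply: measurable_fun_eqr => //; exact: measurable_funM.
- exact: measurable_maxr.
- exact: measurable_minr.
Qed.

Lemma density_integrable p :
  density mu p -> mu.-integrable [set: T] (EFin \o p).
Proof.
move=> [mp p0 p1]; apply/integrableP; split; first exact/measurable_EFinP.
under eq_integral do rewrite /= ger0_norm//.
by rewrite p1 ltry.
Qed.

(** Only infinite exponents need work: the absolute-value forms of max and min are integrated
    termwise, which integrability of [p], [q] and [|p - q|] permits. *)
Lemma power_divergenceE (alpha : \bar R) p q : density mu p -> density mu q ->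
  power_divergence mu alpha p q =
  (\int[mu]_x (ext_power_mean alpha (p x) (q x))%:E)%E.
Proof.
move=> hp hq; have ip := density_integrable hp; have iq := density_integrable hq.
have ipq : mu.-integrable [set: T] (EFin \o (fun x => p x - q x)).
  exact: (integrableB measurableT ip iq).
have inorm : mu.-integrable [set: T] (fun x => (`|p x - q x|)%:E).
  exact: (integrable_norm ipq).
have [_ _ p1] := hp; have [_ _ q1] := hq.
have idem : (2^-1%:E * (1 + 1) = 1 :> \bar R)%E.
  by rewrite -EFinD -EFinM; congr EFin; rewrite mulVf// pnatr_eq0.
case: alpha => [r||] //=.
- under [RHS]eq_integral => x _.
    rewrite maxr_absE (mulrC _ 2^-1) EFinM !EFinD.
    over.
  rewrite integralZl//; last by apply: integrableD => //; exact: integrableD.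
  rewrite integralD//; last exact: integrableD.
  rewrite integralD// p1 q1 -/(variation_distance mu p q).
  (* Distributing over an extended-real sum is legitimate because [1 + 1] is finite. *)
  by rewrite [RHS]muleDr ?idem ?fin_num_adde_defr ?fin_numD.
- under [RHS]eq_integral => x _.
    rewrite minr_absE (mulrC _ 2^-1) EFinM !EFinD EFinN.
    over.
  rewrite integralZl//; last by apply: integrableB => //; exact: integrableD.
  rewrite integralB//; last exact: integrableD.
  rewrite integralD// p1 q1 -/(variation_distance mu p q).
  by rewrite [RHS]muleBr ?idem ?fin_num_adde_defr ?fin_numD.
Qed.

Lemma power_divergence_homo (alpha beta : \bar R) p q :
  density mu p -> density mu q -> (alpha <= beta)%E ->
  (power_divergence mu alpha p q <= power_divergence mu beta p q)%E.
Proof.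
move=> hp hq ab; rewrite !power_divergenceE//.
have [mp p0 _] := hp; have [mq q0 _] := hq.
apply: ge0_le_integral => //.
- move=> x _; rewrite lee_fin.
  (* The integrand is nonnegative because it dominates the minimum of two densities. *)
  apply: le_trans (@ext_power_mean_homo R -oo%E alpha _ _ _ _ _) => //=.
    by rewrite le_min p0 q0.
  by rewrite leNye.
- by apply/measurable_EFinP; exact: measurable_ext_power_mean.
- by apply/measurable_EFinP; exact: measurable_ext_power_mean.
- by move=> x _; rewrite lee_fin ext_power_mean_homo.
Qed.

Lemma harmonic_divergenceE p q : density mu p -> density mu q ->
  harmonic_divergence mu p q = power_divergence mu (-1)%:E p q.
Proof.
move=> [_ p0 _] [_ q0 _]; apply: eq_integral => x _.
by rewrite power_meanN1.
Qed.

Lemma bhattacharyyaE p q : density mu p -> density mu q ->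
  bhattacharyya mu p q = power_divergence mu 0%:E p q.
Proof.
move=> [_ p0 _] [_ q0 _]; apply: eq_integral => x _.
by rewrite power_meanE// ltxx power_mean_pos0.
Qed.

End integrals.

Local Open Scope ereal_scope.

Theorem theorem2 (R : realType) (d : measure_display) (T : measurableType d)
    (mu : {sigma_finite_measure set T -> \bar R}) (p q : T -> R)
    (hp : density mu p) (hq : density mu q) :
  (forall alpha beta : \bar R, alpha < beta ->
    [/\ 1 - (2^-1)%:E * variation_distance mu p q
          <= power_divergence mu alpha p q,
        power_divergence mu alpha p q <= power_divergence mu beta p q &
        power_divergence mu beta p q
          <= 1 + (2^-1)%:E * variation_distance mu p q])
  /\
  [/\ 1 - (2^-1)%:E * variation_distance mu p q <= harmonic_divergence mu p q,
      harmonic_divergence mu p q <= bhattacharyya mu p q &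
      bhattacharyya mu p q <= 1 + (2^-1)%:E * variation_distance mu p q].
Proof.
(* By definition the outer bounds are the divergences at the two infinite exponents. *)
have chain (alpha beta : \bar R) : alpha < beta ->
    [/\ power_divergence mu -oo p q <= power_divergence mu alpha p q,
        power_divergence mu alpha p q <= power_divergence mu beta p q &
        power_divergence mu beta p q <= power_divergence mu +oo p q].
  move=> ab; split; apply: power_divergence_homo => //.
  - exact: leNye.
  - exact: ltW.
  - exact: leey.
split; first exact: chain.
rewrite (harmonic_divergenceE hp hq) (bhattacharyyaE hp hq).
by apply: chain; rewrite lte_fin oppr_lt0.
Qed.
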